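(* Assume that $E,F,\bm f,\bm e,\bm h$ are Lipschitz continuous with respect to their arguments and that Problem $P$ admits an optimal solution $(\bm x^*,\bm u^* )$ with $\bm x^*$ continuously differentiable and $\bm u^*$ continuous on $[0,1]$. Let $(\bm x,\bm u)$ be a feasible solution of Problem $P$ with $\bm x$ continuously differentiable and $\bm u$ continuous on $[0,1]$. Then there is a constant $C_P>0$, independent of $N$, such that, setting $$\delta_P^N = C_P \max\{ W_{x'}(N^{-1/2}),\ W_x(N^{-1/2}),\ W_u(N^{-1/2})\},$$ where $W_{x'},W_x,W_u$ are the moduli of continuity on $[0,1]$ of $\dot{\bm x}$, $\bm x$ and $\bm u$ respectively, Problem $P_N$ with relaxation bound $\delta_P^N$ is feasible (i.e. there exist coefficients $\bar{\bm x}_N,\bar{\bm u}_N$ satisfying all its constraints) for every order $N\in\mathbb{Z}^+$.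
   Context: Notation: $\|\cdot\|$ is the Euclidean norm; $b_{j,N}(t)=\binom{N}{j}t^j(1-t)^{N-j}$, $t\in[0,1]$, are the Bernstein basis polynomials; $t_j=j/N$ for $j=0,\dots,N$; $w=\frac1{N+1}$; $\bm 1$ is the all-ones vector; vector inequalities are componentwise. The modulus of continuity of $\bm g:[0,1]\to\mathbb{R}^n$ is $W_g(\delta)=\sup\{\|\bm g(s)-\bm g(t)\|: s,t\in[0,1],|s-t|\le\delta\}$. Problem $P$: given $E:\mathbb{R}^{n_x}\times\mathbb{R}^{n_x}\to\mathbb{R}$, $F:\mathbb{R}^{n_x}\times\mathbb{R}^{n_u}\to\mathbb{R}$, $\bm f:\mathbb{R}^{n_x}\times\mathbb{R}^{n_u}\to\mathbb{R}^{n_x}$, $\bm e:\mathbb{R}^{n_x}\times\mathbb{R}^{n_x}\to\mathbb{R}^{n_e}$, $\bm h:\mathbb{R}^{n_x}\times\mathbb{R}^{n_u}\to\mathbb{R}^{n_h}$, determine $\bm x:[0,1]\to\mathbb{R}^{n_x}$, $\bm u:[0,1]\to\mathbb{R}^{n_u}$ minimizing $I(\bm x,\bm u)=E(\bm x(0),\bm x(1))+\int_0^1F(\bm x(t),\bm u(t))\,dt$ subject to $\dot{\bm x}(t)=\bm f(\bm x(t),\bm u(t))$ for all $t\in[0,1]$, $\bm e(\bm x(0),\bm x(1))=\bm 0$, and $\bm h(\bm x(t),\bm u(t))\le\bm 0$ for all $t\in[0,1]$. A feasible solution is a pair satisfying these constraints. Problem $P_N$ (with relaxation bound $\delta_P^N$):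 determine coefficients $\bar{\bm x}_N=[\bar{\bm x}_{0,N},\dots,\bar{\bm x}_{N,N}]\in\mathbb{R}^{n_x\times(N+1)}$ and $\bar{\bm u}_N=[\bar{\bm u}_{0,N},\dots,\bar{\bm u}_{N,N}]\in\mathbb{R}^{n_u\times(N+1)}$, with associated Bernstein polynomials $\bm x_N(t)=\sum_{j=0}^N\bar{\bm x}_{j,N}b_{j,N}(t)$ and $\bm u_N(t)=\sum_{j=0}^N\bar{\bm u}_{j,N}b_{j,N}(t)$, minimizing $I_N(\bar{\bm x}_N,\bar{\bm u}_N)=E(\bm x_N(0),\bm x_N(1))+w\sum_{j=0}^NF(\bm x_N(t_j),\bm u_N(t_j))$ subject to $\|\dot{\bm x}_N(t_j)-\bm f(\bm x_N(t_j),\bm u_N(t_j))\|\le\delta_P^N$ for $j=0,\dots,N$, $\bm e(\bm x_N(0),\bm x_N(1))=\bm 0$, and $\bm h(\bm x_N(t_j),\bm u_N(t_j))\le\delta_P^N\bm 1$ for $j=0,\dots,N$. *)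

(* Defs.v *)
From mathcomp Require Import all_boot all_order all_algebra.
From mathcomp Require Import all_classical all_reals all_analysis.

Set Implicit Arguments.
Unset Strict Implicit.
Unset Printing Implicit Defensive.

Import Order.TTheory GRing.Theory Num.Theory.
Import numFieldNormedType.Exports.

Local Open Scope classical_set_scope.
Local Open Scope ring_scope.

(* The Euclidean norm; the library norm on matrices is the sup norm. *)
Definition enorm (R : realType) (n : nat) (v : 'cV[R]_n) : R :=
  Num.sqrt (\sum_(i < n) v i 0 ^+ 2).

(* [nV] is the norm of the codomain: [enorm], or [Num.norm] on scalars. *)
Definition lipschitz2 (R : realType) (p q : nat) (V : zmodType) (nV : V -> R)
    (g : 'cV[R]_p -> 'cV[R]_q -> V) : Prop :=
  exists L : R, forall a b a' b',
    nV (g a b - g a' b') <= L * (enorm (a - a') + enorm (b - b')).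

(* Functions on [0, 1] are represented by total functions on R of which only
   the values on [0, 1] matter: the derivative below is one-sided at 0 and 1. *)
Definition dquot01 (R : realType) (n : nat) (g : R -> 'cV[R]_n) (t s : R) :
  'cV[R]_n := (s - t)^-1 *: (g s - g t).

Definition derivable01 (R : realType) (n : nat) (g : R -> 'cV[R]_n) (t : R) :
  Prop := cvg (dquot01 g t @ within `[0, 1] (t^')).

Definition deriv01 (R : realType) (n : nat) (g : R -> 'cV[R]_n) (t : R) :
  'cV[R]_n := lim (dquot01 g t @ within `[0, 1] (t^')).

Definition C0_01 (R : realType) (n : nat) (g : R -> 'cV[R]_n) : Prop :=
  {within `[0, 1], continuous g}.

Definition C1_01 (R : realType) (n : nat) (g : R -> 'cV[R]_n) : Prop :=
  (forall t, 0 <= t <= 1 -> derivable01 g t) /\ C0_01 (deriv01 g).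

(* [sup] is the genuine supremum for functions bounded on [0, 1], in particular
   continuous ones; it is 0 on unbounded sets. *)
Definition modulus (R : realType) (n : nat) (g : R -> 'cV[R]_n) (delta : R) :
    R :=
  sup [set r | exists s t : R, [/\ 0 <= s <= 1, 0 <= t <= 1,
    `|s - t| <= delta & r = enorm (g s - g t)]].

Definition feasibleP (R : realType) (nx nu ne nh : nat)
    (f : 'cV[R]_nx -> 'cV[R]_nu -> 'cV[R]_nx)
    (e : 'cV[R]_nx -> 'cV[R]_nx -> 'cV[R]_ne)
    (h : 'cV[R]_nx -> 'cV[R]_nu -> 'cV[R]_nh)
    (x : R -> 'cV[R]_nx) (u : R -> 'cV[R]_nu) : Prop :=
  [/\ forall t, 0 <= t <= 1 ->
        derivable01 x t /\ deriv01 x t = f (x t) (u t),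
      e (x 0) (x 1) = 0
    & forall t, 0 <= t <= 1 -> forall i, h (x t) (u t) i 0 <= 0].

Definition cost_defined (R : realType) (nx nu : nat)
    (F : 'cV[R]_nx -> 'cV[R]_nu -> R)
    (x : R -> 'cV[R]_nx) (u : R -> 'cV[R]_nu) : Prop :=
  (@lebesgue_measure R).-integrable `[0, 1] (fun t => (F (x t) (u t))%:E).

Definition cost (R : realType) (nx nu : nat)
    (E : 'cV[R]_nx -> 'cV[R]_nx -> R) (F : 'cV[R]_nx -> 'cV[R]_nu -> R)
    (x : R -> 'cV[R]_nx) (u : R -> 'cV[R]_nu) : R :=
  E (x 0) (x 1) + \int[@lebesgue_measure R]_(t in `[0, 1]) F (x t) (u t).

(* Competitors are all feasible pairs for which the integral in the cost makes
   sense (the junk value of the integral is irrelevant otherwise). *)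
Definition optimalP (R : realType) (nx nu ne nh : nat)
    (E : 'cV[R]_nx -> 'cV[R]_nx -> R) (F : 'cV[R]_nx -> 'cV[R]_nu -> R)
    (f : 'cV[R]_nx -> 'cV[R]_nu -> 'cV[R]_nx)
    (e : 'cV[R]_nx -> 'cV[R]_nx -> 'cV[R]_ne)
    (h : 'cV[R]_nx -> 'cV[R]_nu -> 'cV[R]_nh)
    (x : R -> 'cV[R]_nx) (u : R -> 'cV[R]_nu) : Prop :=
  [/\ feasibleP f e h x u, cost_defined F x u
    & forall x' u', feasibleP f e h x' u' -> cost_defined F x' u' ->
        cost E F x u <= cost E F x' u'].

Definition bernstein (R : realType) (N j : nat) (t : R) : R :=
  'C(N, j)%:R * t ^+ j * (1 - t) ^+ (N - j).

(* Column [j] of [c] is the [j]-th Bernstein coefficient. *)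
Definition bpoly (R : realType) (n N : nat) (c : 'M[R]_(n, N.+1)) (t : R) :
  'cV[R]_n := \sum_(j < N.+1) bernstein N j t *: col j c.

Definition feasiblePN (R : realType) (nx nu ne nh : nat)
    (f : 'cV[R]_nx -> 'cV[R]_nu -> 'cV[R]_nx)
    (e : 'cV[R]_nx -> 'cV[R]_nx -> 'cV[R]_ne)
    (h : 'cV[R]_nx -> 'cV[R]_nu -> 'cV[R]_nh)
    (N : nat) (delta : R)
    (cx : 'M[R]_(nx, N.+1)) (cu : 'M[R]_(nu, N.+1)) : Prop :=
  let xN := bpoly cx in
  let uN := bpoly cu in
  let node (j : 'I_N.+1) : R := j%:R / N%:R in
  [/\ forall j, enorm (deriv01 xN (node j) - f (xN (node j)) (uN (node j)))
                <= delta,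
      e (xN 0) (xN 1) = 0
    & forall j i, h (xN (node j)) (uN (node j)) i 0 <= delta].

(* Main.v *)
Require Import Defs.
From mathcomp Require Import all_boot all_order all_algebra.
From mathcomp Require Import all_classical all_reals all_analysis.
From mathcomp Require Import ring lra.

Import Order.TTheory GRing.Theory Num.Theory.
Import numFieldNormedType.Exports.

Local Open Scope classical_set_scope.
Local Open Scope ring_scope.

(** The feasible point of the discrete problem is the Bernstein approximation of
    [x] and [u]: the coefficients are the values of [x] and [u] at the nodes
    [j / N]. A Bernstein polynomial interpolates its first and last
    coefficients, so the boundary condition is met exactly.

    The polynomials stay within a constant times the moduli of continuity at
    scale [d = N ^ (-1/2)] of [x] and [u], and the derivative of the first one
    stays as close to the derivative of [x] ([bpoly_values_approx],
    [bpoly_values_deriv_approx]). The differential equation and the path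
    constraint hold along [(x, u)], and [f] and [h] are Lipschitz, so both are
    violated at the nodes by at most a constant times the largest modulus.

    The estimate behind both approximation results is [bernstein_approx]. A
    Bernstein polynomial at [t] is an expectation under the binomial law with
    success probability [t]. An increment of a function over a distance
    [`|s - t|] is at most [1 + (s - t) ^+ 2 / d ^+ 2] times its modulus at scale
    [d] ([increment_le_sqr]); since the binomial variance makes the mean of
    [(s - t) ^+ 2] of order [1 / N = d ^+ 2], the expected increment is at most
    a constant times the modulus. For the derivative, the coefficients are
    slopes between nodes, hence by the mean value theorem values of the
    derivative close to the nodes ([bernstein_sum_derive], [MVT01]).

    All estimates are made coordinate by coordinate; the passage back to the
    Euclidean norm costs a factor equal to the dimension. *)

(** * Bernstein sums as binomial expectations *)

Section BernsteinSum.
Variable R : realType.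
Implicit Types (phi : nat -> R) (t : R).

(** The expectation of [phi] under the binomial law with parameters [N] and
    [t]; as a function of [t], the Bernstein polynomial with coefficients
    [phi j]. *)
Definition bernstein_sum N phi t : R :=
  \sum_(j < N.+1) bernstein N j t * phi j.

Lemma bernstein_ge0 N j t : 0 <= t <= 1 -> 0 <= bernstein N j t.
Proof.
by move=> /andP[t0 t1]; rewrite /bernstein !mulr_ge0 ?exprn_ge0 ?subr_ge0.
Qed.

(** Condition on the first of the [N.+1] trials: by Pascal's rule it succeeds
    with probability [t] and then shifts the count by one. The end values, the
    moments and the derivative below all follow from it by induction on [N]. *)
Lemma bernstein_sum_recur N phi t :
  bernstein_sum N.+1 phi t =
  t * bernstein_sum N (phi \o succn) t + (1 - t) * bernstein_sum N phi t.
Proof.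
rewrite /bernstein_sum big_ord_recl /= [X in _ = _ + _ * X]big_ord_recl /=.
rewrite mulrDr !mulr_sumr [RHS]addrCA; congr (_ + _).
  by rewrite /bernstein !bin0 !expr0 !subn0 exprS; ring.
rewrite big_ord_recr/= [X in _ = X + _]big_ord_recr/= [RHS]addrAC.
congr (_ + _); last first.
  by rewrite /bernstein /bump /= !add1n !binn !subnn !exprS; ring.
rewrite -big_split /=; apply: eq_bigr => i _.
rewrite /bernstein /bump /= !add1n binS subSS exprS.
rewrite -[in LHS](subnSK (ltn_ord i)) -[in X in _ = X + _](subnSK (ltn_ord i)).
by rewrite !natrD !exprS; ring.
Qed.

Lemma bernstein_sum0 phi t : bernstein_sum 0 phi t = phi 0%N.
Proof.
by rewrite /bernstein_sum big_ord1 /bernstein bin0 subnn !expr0 !mul1r.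
Qed.

Lemma bernstein_sum_at0 N phi :
  bernstein_sum N phi 0 = phi 0%N.
Proof.
elim: N => [|N IH]; first exact: bernstein_sum0.
by rewrite bernstein_sum_recur IH; ring.
Qed.

Lemma bernstein_sum_at1 N phi :
  bernstein_sum N phi 1 = phi N.
Proof.
elim: N phi => [|N IH] phi; first exact: bernstein_sum0.
by rewrite bernstein_sum_recur IH /=; ring.
Qed.

Lemma eq_bernstein_sum N phi psi t : phi =1 psi ->
  bernstein_sum N phi t = bernstein_sum N psi t.
Proof. by move=> eq_phi; apply: eq_bigr => j _; rewrite eq_phi. Qed.

Lemma bernstein_sumB N phi psi t :
  bernstein_sum N (fun j => phi j - psi j) t =
  bernstein_sum N phi t - bernstein_sum N psi t.
Proof. by rewrite /bernstein_sum -sumrB; apply: eq_bigr => j _; ring. Qed.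

Lemma bernstein_sum_cst N (c t : R) : bernstein_sum N (fun=> c) t = c.
Proof.
elim: N => [|N IH]; first by rewrite bernstein_sum0.
by rewrite bernstein_sum_recur IH; ring.
Qed.

(** Variance plus squared bias of the binomial law. The centre [c] is kept
    arbitrary because the recurrence replaces it by [c - 1]. *)
Lemma bernstein_sum_sqr N (c t : R) :
  bernstein_sum N (fun j => (j%:R - c) ^+ 2) t =
  N%:R * (t * (1 - t)) + (N%:R * t - c) ^+ 2.
Proof.
elim: N c => [|N IH] c; first by rewrite bernstein_sum0; ring.
rewrite bernstein_sum_recur IH.
under [X in t * X]eq_bernstein_sum => j.
  rewrite /= (_ : j.+1%:R - c = j%:R - (c - 1)); last by rewrite -natr1; ring.
  over.
by rewrite IH -natr1; ring.
Qed.

(** Differentiating the recurrence adds one first difference of [phi] to the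
    [N] ones that the induction hypothesis provides. At [N = 0] the predecessor
    of [N] is a dummy, since the factor [N] vanishes. *)
Lemma bernstein_sum_derive N phi t :
  is_derive t 1 (bernstein_sum N phi)
    (N%:R * bernstein_sum N.-1 (fun j => phi j.+1 - phi j) t).
Proof.
elim: N phi => [|N IH] phi.
  rewrite mul0r (_ : bernstein_sum 0 phi = cst (phi 0%N)).
    exact: is_derive_cst.
  by apply/funext => s; rewrite bernstein_sum0.
rewrite (_ : bernstein_sum N.+1 phi =
  id * bernstein_sum N (phi \o succn) + (cst 1 - id) * bernstein_sum N phi);
  last by apply/funext => s; rewrite bernstein_sum_recur.
apply: is_derive_eq.
rewrite /= /GRing.scale /= sub0r.
case: N {IH} => [|N] /=; first by rewrite !bernstein_sum0 /=; ring.
rewrite [in RHS]bernstein_sum_recur !bernstein_sumB -!natr1 /=.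
rewrite (_ : (cst 1 - id) t = 1 - t) // !bernstein_sum_recur /comp /=.
ring.
Qed.
End BernsteinSum.

Arguments bernstein_sum {R}.

(** * Increments of a function and its Bernstein approximation *)

Section Approximation.
Variable R : realType.
Implicit Types (g : R -> R) (d w s t : R).

(** Chaining: a segment of length at most [k.+1 * d] is cut into [k.+1] equal
    pieces, which stay in the unit interval by convexity. *)
Lemma increment_iter g d w k :
  (forall s t, 0 <= s <= 1 -> 0 <= t <= 1 -> `|s - t| <= d ->
     `|g s - g t| <= w) ->
  forall s t, 0 <= s <= 1 -> 0 <= t <= 1 -> `|s - t| <= k.+1%:R * d ->
    `|g s - g t| <= k.+1%:R * w.
Proof.
move=> gw; elim: k => [|k IH] s t s01 t01; first by rewrite !mul1r; exact: gw.
(* [p] ends the first of the [k.+2] equal pieces, counted from [s]. *)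
move=> std; pose p := s + (t - s) / k.+2%:R.
have k2 : 0 < k.+2%:R :> R by rewrite ltr0n.
have k1 : 0 < k.+1%:R :> R by rewrite ltr0n.
have k12 : k.+2%:R = k.+1%:R + 1 :> R by rewrite -natr1.
have sp : s - p = (s - t) / k.+2%:R by rewrite /p; field; lra.
have pt : p - t = k.+1%:R * ((s - t) / k.+2%:R).
  by rewrite /p k12; field; lra.
have q_ge0 : 0 <= k.+2%:R^-1 :> R by rewrite invr_ge0 ltW.
have q_le1 : k.+2%:R^-1 <= 1 :> R by rewrite invf_le1 ?ler1n.
have p01 : 0 <= p <= 1.
  by rewrite /p; set q := _^-1 in q_ge0 q_le1 *; apply/andP; split; nra.
have std' : `|(s - t) / k.+2%:R| <= d.
  by rewrite normrM (ger0_norm q_ge0) ler_pdivrMr // mulrC.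
rewrite k12 (_ : g s - g t = (g p - g t) + (g s - g p)); last by ring.
rewrite mulrDl mul1r (le_trans (ler_normD _ _))// lerD//.
  apply: IH => //; rewrite pt normrM ger0_norm ?(ltW k1)//.
  by rewrite ler_pM2l.
by apply: gw => //; rewrite sp.
Qed.

(** The number of steps of length [d] needed to join [s] and [t] is at most
    [1 + k], with [k] the integer part of [`|s - t| / d]; and [k <= k ^ 2].
    The square makes the bound integrable against a binomial law through its
    variance alone. *)
Lemma increment_le_sqr g d w : 0 < d ->
  (forall s t, 0 <= s <= 1 -> 0 <= t <= 1 -> `|s - t| <= d ->
     `|g s - g t| <= w) ->
  forall s t, 0 <= s <= 1 -> 0 <= t <= 1 ->
    `|g s - g t| <= (1 + (s - t) ^+ 2 / d ^+ 2) * w.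
Proof.
move=> d0 gw s t s01 t01.
have w0 : 0 <= w.
  by have := gw _ _ s01 s01; rewrite !subrr !normr0; apply; exact: ltW.
pose r := `|s - t| / d; have r0 : 0 <= r by rewrite divr_ge0 // ltW.
have /andP[kr rk] := truncn_itv r0; set k := Num.truncn r in kr rk.
have -> : (s - t) ^+ 2 / d ^+ 2 = r ^+ 2.
  by rewrite expr_div_n -normrX ger0_norm ?sqr_ge0.
have st_le : `|s - t| <= k.+1%:R * d by rewrite -ler_pdivrMr // ltW.
apply: le_trans (increment_iter g d w k gw s t s01 t01 st_le) _.
rewrite ler_wpM2r // -natr1 addrC lerD2l.
apply: (@le_trans _ _ (k%:R ^+ 2)); last by rewrite lerXn2r ?nnegrE.
by rewrite -natrX ler_nat; case: (k) => // m; rewrite -mulnn leq_pmulr.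
Qed.

(** Averaging the quadratic bound on increments against the binomial law of
    [M] trials. The hypothesis on the evaluation points [a j] says that
    [N * (a j - t)] is within [1] of [j - M * t], whose variance is at most
    [N / 4]; the mean of [(a j - t) ^+ 2] is thus at most [5 / (2 * N)], and
    [d] is the corresponding scale. The case [M = N], [a j = j / N] is the
    classical Bernstein operator; the case [M = N.-1], with [a j] in the cell
    between [j / N] and [j.+1 / N], is its derivative. *)
Lemma bernstein_approx g d w (N M : nat) (a : nat -> R) t :
  (0 < N)%N -> (M <= N)%N -> 0 < d -> d ^+ 2 = N%:R^-1 ->
  (forall s t, 0 <= s <= 1 -> 0 <= t <= 1 -> `|s - t| <= d ->
     `|g s - g t| <= w) ->
  0 <= t <= 1 ->
  (forall j, (j <= M)%N -> 0 <= a j <= 1) ->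
  (forall j, (j <= M)%N -> `|N%:R * a j - j%:R - (N%:R - M%:R) * t| <= 1) ->
  `|bernstein_sum M (g \o a) t - g t| <= 4 * w.
Proof.
move=> N0 MN d0 d2 gw t01 a01 aj.
have w0 : 0 <= w.
  by have := gw _ _ t01 t01; rewrite !subrr !normr0; apply; exact: ltW.
have N0' : 1 <= N%:R :> R by rewrite ler1n.
rewrite -{1}(bernstein_sum_cst _ M (g t) t) -bernstein_sumB.
apply: (@le_trans _ _ (bernstein_sum M
  (fun j => (1 + 2 * ((j%:R - M%:R * t) ^+ 2 + 1) / N%:R) * w) t)).
  rewrite /bernstein_sum (le_trans (ler_norm_sum _ _ _))// ler_sum // => j _.
  have jM : (j <= M)%N by rewrite -ltnS.
  rewrite normrM ger0_norm ?bernstein_ge0 // ler_wpM2l ?bernstein_ge0 //.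
  apply: le_trans (increment_le_sqr g d w d0 gw _ _ (a01 _ jM) t01) _.
  rewrite ler_wpM2r // lerD2l d2 invrK ler_pdivlMr; last by lra.
  have := aj _ jM; rewrite ler_norml => /andP[].
  set b := N%:R * a j - _ - _ => b1 b2.
  rewrite -mulrA -expr2 -exprMn [(_ - t) * _]mulrC.
  have -> : N%:R * (a j - t) = b + (j%:R - M%:R * t) by rewrite /b; ring.
  (* [(b + c) ^+ 2 <= 2 * c ^+ 2 + 2 * b ^+ 2], from [(c - b) ^+ 2 >= 0]. *)
  set c := j%:R - _.
  have b_sqr : b ^+ 2 <= 1 by nra.
  have cb_sqr : 0 <= (c - b) ^+ 2 by rewrite sqr_ge0.
  by nra.
(* The bound is affine in [(j - M t) ^+ 2], so that linearity applies. *)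
have -> : (fun j => (1 + 2 * ((j%:R - M%:R * t) ^+ 2 + 1) / N%:R) * w) =
  (fun j => (w + 2 / N%:R * w) - (- (2 / N%:R * w)) * (j%:R - M%:R * t) ^+ 2).
  by apply/funext => j; ring.
rewrite bernstein_sumB bernstein_sum_cst.
have -> : bernstein_sum M
  (fun j => - (2 / N%:R * w) * (j%:R - M%:R * t) ^+ 2) t =
   - (2 / N%:R * w) * bernstein_sum M (fun j => (j%:R - M%:R * t) ^+ 2) t.
  by rewrite /bernstein_sum mulr_sumr; apply: eq_bigr => j _; ring.
rewrite bernstein_sum_sqr subrr expr0n addr0.
have MN' : M%:R <= N%:R :> R by rewrite ler_nat.
have M0 : 0 <= M%:R :> R by [].
have v : M%:R * (t * (1 - t)) <= N%:R / 4.
  have var_le : t * (1 - t) <= 1 / 4.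
    by have := sqr_ge0 (2 * t - 1); nra.
  by nra.
set V := M%:R * (t * (1 - t)) in v *.
rewrite (_ : _ - _ = (1 + 2 * (1 + V) / N%:R) * w); last by ring.
rewrite ler_wpM2r // (_ : 4 = 1 + 3 :> R); last by ring.
by rewrite lerD2l ler_pdivrMr; lra.
Qed.
End Approximation.

(** * Coordinates of vectors, moduli of continuity and one-sided derivatives *)

Lemma coord_le_enorm (R : realType) n (v : 'cV[R]_n) i : `|v i 0| <= enorm v.
Proof.
rewrite /enorm -sqrtr_sqr ler_sqrt; last first.
  by rewrite sumr_ge0 // => ? _; exact: sqr_ge0.
by rewrite (bigD1 i) //= lerDl sumr_ge0 // => ? _; exact: sqr_ge0.
Qed.

(** The factor [n] is larger than the optimal square root of [n], but it is all
    that a constant independent of the order requires. *)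
Lemma enorm_le (R : realType) n (v : 'cV[R]_n) (c : R) :
  0 <= c -> (forall i, `|v i 0| <= c) -> enorm v <= n%:R * c.
Proof.
move=> c0 vc; have nc0 : 0 <= n%:R * c by rewrite mulr_ge0.
rewrite -[leRHS](ger0_norm nc0) -sqrtr_sqr ler_sqrt ?sqr_ge0 //.
apply: (@le_trans _ _ (\sum_(i < n) c ^+ 2)).
  by apply: ler_sum => i _; rewrite -real_normK ?num_real // lerXn2r ?nnegrE.
rewrite sumr_const card_ord -[leLHS]mulr_natl exprMn.
apply: ler_wpM2r; first exact: sqr_ge0.
by rewrite -natrX ler_nat; case: n {v vc nc0} => // n; rewrite -mulnn leq_pmulr.
Qed.

Lemma C0_01_bounded (R : realType) n (g : R -> 'cV[R]_n) : C0_01 g ->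
  exists B : R, forall t, 0 <= t <= 1 -> forall i, `|g t i 0| <= B.
Proof.
move=> cg.
have /compact_bounded[B [_ gB]] : compact (g @` `[0, 1]).
  by apply: continuous_compact => //; exact: segment_compact.
exists (B + 1) => t t01 i.
apply: le_trans (gB (B + 1) _ (g t) _); last 2 first.
  by rewrite ltrDl.
  by exists t => //; rewrite /= in_itv.
rewrite [leRHS]/Num.norm /= mx_normrE.
exact: (le_trans _ (le_bigmax _ _ (i, 0))).
Qed.

(** Continuity matters here: it makes the set of increments bounded, so that
    its [sup] is an upper bound. *)
Lemma le_modulus (R : realType) n (g : R -> 'cV[R]_n) (d s t : R) : C0_01 g ->
  0 <= s <= 1 -> 0 <= t <= 1 -> `|s - t| <= d ->
  enorm (g s - g t) <= modulus g d.
Proof.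
move=> /C0_01_bounded[B gB] s01 t01 std.
apply: ub_le_sup; last by exists s, t.
exists (n%:R * (B + B)) => _ [s' [t' [s'01 t'01 _ ->]]].
case: n g gB => [|n] g gB.
  by rewrite /enorm big_ord0 sqrtr0 mul0r.
have B0 : 0 <= B by rewrite (le_trans _ (gB _ s01 ord0)).
apply: enorm_le => [|i]; first exact: addr_ge0.
by rewrite !mxE (le_trans (ler_normB _ _)) // lerD // gB.
Qed.

(** Every point of the unit interval is a limit point of it, endpoints
    included, which makes one-sided limits unique there. *)
Lemma within_dnbhs01_proper (R : realType) (t : R) : 0 <= t <= 1 ->
  ProperFilter (within `[0, 1] t^').
Proof.
move=> /andP[t0 t1]; apply: Build_ProperFilter_ex => B.
rewrite /within /= => -[/= e e0 eB].
have [t_lt1|t_ge1] := ltP t 1.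
  exists (Num.min 1 (t + e / 2)); rewrite minElt; apply: eB.
  - by rewrite /= ltr_distlC; case: ifPn => ?; apply/andP; split; lra.
  - by case: ifPn => ?; apply/eqP; lra.
  - by rewrite /= in_itv /=; case: ifPn => ?; apply/andP; split; lra.
exists (Num.max 0 (t - e / 2)); rewrite maxElt; apply: eB.
- by rewrite /= ltr_distlC; case: ifPn => ?; apply/andP; split; lra.
- by case: ifPn => ?; apply/eqP; lra.
- by rewrite /= in_itv /=; case: ifPn => ?; apply/andP; split; lra.
Qed.

Lemma derivable01_coord (R : realType) n (g : R -> 'cV[R]_n) (t : R) i :
  derivable01 g t ->
  dquot01 g t s i 0 @[s --> within `[0, 1] t^'] --> deriv01 g t i 0.
Proof.
move=> dg.
exact: (cvg_comp (dquot01 g t) (fun v : 'cV[R]_n => v i 0) dg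
  (@coord_continuous _ _ _ i 0 _)).
Qed.

(** The two-sided derivatives of the coordinates determine [deriv01], also at
    the endpoints: this computes [deriv01] of a polynomial curve. *)
Lemma deriv01_coordE (R : realType) n (g : R -> 'cV[R]_n) (t : R)
    (D : 'cV[R]_n) : 0 <= t <= 1 ->
  (forall i, is_derive t 1 (fun s => g s i 0) (D i 0)) ->
  forall i, deriv01 g t i 0 = D i 0.
Proof.
move=> t01 gD; have PF := within_dnbhs01_proper _ _ t01.
have cvgD i : dquot01 g t s i 0 @[s --> within `[0, 1] t^'] --> D i 0.
  have dgi : h^-1 *: (((fun s => g s i 0) \o shift t) (h *: 1) - g t i 0)
      @[h --> 0^'] --> D i 0.
    by have [dgi <-] := gD i; exact: dgi.
  apply/cvgrPdist_le => e e0.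
  have /cvgrPdist_le/(_ e e0)[d d0 quot_le] := dgi; exists d => // s std sNt _.
  have := quot_le (s - t).
  rewrite /= sub0r normrN distrC => /(_ std); rewrite subr_eq0 => /(_ sNt).
  by rewrite /dquot01 !mxE /GRing.scale /= mulr1 subrK.
have dg : derivable01 g t.
  apply/cvg_ex; exists D; apply/cvgrPdist_le => /= e e0; near=> s.
  rewrite /Num.Def.normr /= mx_normrE (bigmax_le _ (ltW e0)) //= => -[i j] _.
  rewrite 2!mxE /= (ord1 j).
  move: i {j}; near: s; apply: filter_forall => /= i.
  exact: ((cvgrPdist_le _ _).1 (cvgD i) e e0).
by move=> i; exact: (cvg_unique _ (derivable01_coord _ _ _ _ i dg) (cvgD i)).
Unshelve. all: by end_near. Qed.

(** Inside the interval the constraint to stay in it is void near [t]; the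
    endpoints are excluded because nothing is known of [g] outside. *)
Lemma derivable01_is_derive (R : realType) n (g : R -> 'cV[R]_n) (t : R) i :
  0 < t < 1 -> derivable01 g t ->
  is_derive t 1 (fun s => g s i 0) (deriv01 g t i 0).
Proof.
move=> /andP[t0 t1] /(derivable01_coord _ _ _ _ i) /cvgrPdist_le dg.
suff quot_cvg : h^-1 *: (((fun s => g s i 0) \o shift t) (h *: 1) - g t i 0)
    @[h --> 0^'] --> deriv01 g t i 0.
  by split; [exact: cvgP quot_cvg | exact: cvg_lim quot_cvg].
apply/cvgrPdist_le => e e0; have [d /= d0 quot_le] := dg e e0.
exists (Num.min d (Num.min t (1 - t))).
  by rewrite /= !lt_min d0 t0 subr_gt0.
move=> h /=; rewrite sub0r normrN !lt_min => /and3P[hd ht h1t] h0.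
have := quot_le (h + t); rewrite /= opprD addrCA subrr addr0 normrN => /(_ hd).
rewrite -subr_eq0 addrK => /(_ h0); rewrite in_itv /=.
move: ht h1t; rewrite !ltr_norml => /andP[h_ge _] /andP[_ h_le].
have -> : 0 <= h + t <= 1 by apply/andP; split; lra.
by move=> /(_ isT); rewrite /dquot01 !mxE addrK /GRing.scale /= mulr1.
Qed.

Lemma derivable01_coord_continuous (R : realType) n (g : R -> 'cV[R]_n) i :
  (forall t, 0 <= t <= 1 -> derivable01 g t) ->
  {within `[0, 1], continuous (fun t => g t i 0)}.
Proof.
move=> dg; apply/subspace_continuousP => t t01.
have {}t01 : 0 <= t <= 1 by move: t01; rewrite /= in_itv.
have /= dgt := derivable01_coord _ _ _ _ i (dg t t01).
have PF := within_dnbhs01_proper _ _ t01.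
have id_cvg : (s - t) @[s --> within `[0, 1] t^'] --> (0 : R).
  rewrite -(subrr t); apply: cvgB; last exact: cvg_cst.
  by apply: cvg_within_filter; apply: cvg_within_filter; exact: cvg_id.
have /cvgrPdist_le incr_cvg :
    (s - t) * dquot01 g t s i 0 @[s --> within `[0, 1] t^'] --> (0 : R).
  rewrite -[X in _ --> X](mul0r (deriv01 g t i 0)); exact: cvgM.
apply/cvgrPdist_le => e e0; have [d /= d0 incr_le] := incr_cvg e e0.
exists d => // s std s01; have [->|sNt] := eqVneq s t.
  by rewrite subrr normr0 ltW.
have := incr_le s std sNt s01; rewrite sub0r normrN /dquot01 !mxE.
by rewrite mulVKf ?subr_eq0 // distrC.
Qed.

Lemma coord_C0_01 (R : realType) n (g : R -> 'cV[R]_n) :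
  (forall i, {within `[0, 1], continuous (fun t => g t i 0)}) -> C0_01 g.
Proof.
move=> cg; apply/subspace_continuousP => t t01.
apply/cvgrPdist_le => /= e e0; near=> s.
rewrite /Num.Def.normr /= mx_normrE (bigmax_le _ (ltW e0)) //= => -[i j] _.
rewrite !mxE /= (ord1 j).
move: i {j}; near: s; apply: filter_forall => /= i.
have /subspace_continuousP/(_ t t01)/cvgrPdist_le/(_ e e0) := cg i.
exact.
Unshelve. all: by end_near. Qed.

(** The intermediate point depends on the coordinate [i]: there is no mean value
    theorem for vectors, which is why the estimates are made coordinatewise. *)
Lemma MVT01 (R : realType) n (g : R -> 'cV[R]_n) i (a b : R) :
  (forall t, 0 <= t <= 1 -> derivable01 g t) ->
  0 <= a -> a < b -> b <= 1 ->
  exists2 c, a < c < b & g b i 0 - g a i 0 = deriv01 g c i 0 * (b - a).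
Proof.
move=> dg a0 ab b1.
have [||c] := @MVT R (fun t => g t i 0) (fun t => deriv01 g t i 0) a b ab.
- move=> t; rewrite in_itv /= => /andP[at_ tb].
  by apply: derivable01_is_derive; [|apply: dg]; apply/andP; split; lra.
- apply: continuous_subspaceW (derivable01_coord_continuous _ _ g i dg).
  by move=> t /=; rewrite !in_itv /= => /andP[at_ tb]; apply/andP; split; lra.
- by rewrite in_itv /= => abc gab; exists c.
Qed.

(** * Bernstein polynomials with sampled coefficients *)

Definition node_values (R : realType) n (N : nat) (g : R -> 'cV[R]_n) :
  'M[R]_(n, N.+1) := \matrix_(i, j) g (j%:R / N%:R) i 0.
Arguments node_values {R n}.

Lemma bpoly_valuesE (R : realType) n N (g : R -> 'cV[R]_n) t i :
  bpoly (node_values N g) t i 0 =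
  bernstein_sum N (fun j => g (j%:R / N%:R) i 0) t.
Proof.
rewrite /bpoly summxE; apply: eq_bigr => j _.
by rewrite !mxE.
Qed.

Lemma bpoly_values0 (R : realType) n N (g : R -> 'cV[R]_n) :
  bpoly (node_values N g) 0 = g 0.
Proof.
apply/matrixP => i j; rewrite (ord1 j) bpoly_valuesE bernstein_sum_at0.
by rewrite mul0r.
Qed.

Lemma bpoly_values1 (R : realType) n N (g : R -> 'cV[R]_n) : (0 < N)%N ->
  bpoly (node_values N g) 1 = g 1.
Proof.
move=> N0; apply/matrixP => i j.
rewrite (ord1 j) bpoly_valuesE bernstein_sum_at1.
by rewrite divff // pnatr_eq0 -lt0n.
Qed.

Lemma bpoly_values_approx (R : realType) n N (g : R -> 'cV[R]_n) (d t : R) i :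
  C0_01 g -> (0 < N)%N -> 0 < d -> d ^+ 2 = N%:R^-1 -> 0 <= t <= 1 ->
  `|bpoly (node_values N g) t i 0 - g t i 0| <= 4 * modulus g d.
Proof.
move=> cg N0 d0 d2 t01.
have N0' : 0 < N%:R :> R by rewrite ltr0n.
rewrite bpoly_valuesE.
apply: (bernstein_approx R (fun s => g s i 0) d (modulus g d) N N
  (fun j => j%:R / N%:R)) => //.
- move=> s s' s01 s'01 ss'.
  apply: le_trans (le_modulus _ _ g d s s' cg s01 s'01 ss').
  by have := coord_le_enorm _ _ (g s - g s') i; rewrite !mxE.
- by move=> j jN; rewrite divr_ge0 //= ler_pdivrMr // mul1r ler_nat.
- move=> j _; rewrite mulrCA divff ?gt_eqF //.
  by rewrite subrr mul0r mulr1 subrr subr0 normr0.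
Qed.

(** The derivative is the Bernstein polynomial of order [N.-1] whose
    coefficients are the slopes of [g] between consecutive nodes. By the mean
    value theorem these are values of [deriv01 g] at points of the cells, so
    that the approximation estimate applies to [deriv01 g]. *)
Lemma bpoly_values_deriv_approx (R : realType) n N (g : R -> 'cV[R]_n)
    (d t : R) i :
  C1_01 g -> (0 < N)%N -> 0 < d -> d ^+ 2 = N%:R^-1 -> 0 <= t <= 1 ->
  `|deriv01 (bpoly (node_values N g)) t i 0 - deriv01 g t i 0| <=
  4 * modulus (deriv01 g) d.
Proof.
move=> [dg cg] N0 d0 d2 t01.
have N0' : 0 < N%:R :> R by rewrite ltr0n.
(* The bound on [j] is inside the existential for choice to apply on [nat]. *)
have mvt j : exists c, (j <= N.-1)%N ->
    j%:R / N%:R < c < j.+1%:R / N%:R /\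
    N%:R * (g (j.+1%:R / N%:R) i 0 - g (j%:R / N%:R) i 0) = deriv01 g c i 0.
  have [jN|jN] := leqP j N.-1; last by exists 0.
  have [|||c jc gc] := MVT01 R n g i (j%:R / N%:R) (j.+1%:R / N%:R) dg.
  - by rewrite divr_ge0.
  - by rewrite ltr_pM2r ?invr_gt0 // ltr_nat.
  - by rewrite ler_pdivrMr // mul1r ler_nat -(prednK N0).
  exists c => _; split => //; rewrite gc -mulrBl -natrB // subSnn mul1r.
  by rewrite mulrCA divff ?gt_eqF // mulr1.
have [xi xiP] := choice mvt.
pose D : 'cV[R]_n := \col_k (N%:R * bernstein_sum N.-1
  (fun j => g (j.+1%:R / N%:R) k 0 - g (j%:R / N%:R) k 0) t).
have -> : deriv01 (bpoly (node_values N g)) t i 0 = D i 0.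
  apply: deriv01_coordE => // k.
  rewrite mxE (_ : (fun s => _) =
    bernstein_sum N (fun j => g (j%:R / N%:R) k 0)).
    exact: bernstein_sum_derive.
  by apply/funext => s; rewrite bpoly_valuesE.
rewrite mxE.
have -> : N%:R * bernstein_sum N.-1
  (fun j => g (j.+1%:R / N%:R) i 0 - g (j%:R / N%:R) i 0) t =
  bernstein_sum N.-1 ((fun s => deriv01 g s i 0) \o xi) t.
  rewrite /bernstein_sum mulr_sumr; apply: eq_bigr => j _.
  have /xiP[_ /= <-] : (j <= N.-1)%N by rewrite -ltnS.
  by ring.
apply: (bernstein_approx R (fun s => deriv01 g s i 0) d
  (modulus (deriv01 g) d) N) => //.
- exact: leq_pred.
- move=> s s' s01 s'01 ss'.
  apply: le_trans (le_modulus _ _ (deriv01 g) d s s' cg s01 s'01 ss').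
  by have := coord_le_enorm _ _ (deriv01 g s - deriv01 g s') i; rewrite !mxE.
- move=> j jN; have [/andP[jxi xij] _] := xiP j jN.
  rewrite (le_trans _ (ltW jxi)) ?divr_ge0 //= (le_trans (ltW xij)) //.
  by rewrite ler_pdivrMr // mul1r ler_nat -(prednK N0).
- move=> j jN; have [/andP[]] := xiP j jN.
  rewrite ltr_pdivrMr // ltr_pdivlMr // => jxi xij _.
  have -> : N%:R - N.-1%:R = 1 :> R.
    by rewrite -[in N%:R](prednK N0) -natr1; ring.
  by move: xij; rewrite -natr1 ler_norml mul1r => ?; apply/andP; split; lra.
Qed.

(** * Feasibility of the discretized problem *)

Theorem theorem1 (R : realType) (nx nu ne nh : nat)
  (E : 'cV[R]_nx -> 'cV[R]_nx -> R)
  (F : 'cV[R]_nx -> 'cV[R]_nu -> R)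
  (f : 'cV[R]_nx -> 'cV[R]_nu -> 'cV[R]_nx)
  (e : 'cV[R]_nx -> 'cV[R]_nx -> 'cV[R]_ne)
  (h : 'cV[R]_nx -> 'cV[R]_nu -> 'cV[R]_nh)
  (lipE : lipschitz2 Num.norm E)
  (lipF : lipschitz2 Num.norm F)
  (lipf : lipschitz2 (@enorm R nx) f)
  (lipe : lipschitz2 (@enorm R ne) e)
  (liph : lipschitz2 (@enorm R nh) h)
  (optimal_exists : exists (xs : R -> 'cV[R]_nx) (us : R -> 'cV[R]_nu),
     [/\ optimalP E F f e h xs us, C1_01 xs & C0_01 us])
  (x : R -> 'cV[R]_nx) (u : R -> 'cV[R]_nu)
  (feas_xu : feasibleP f e h x u) (C1x : C1_01 x) (C0u : C0_01 u) :
  exists CP : R, 0 < CP /\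
    forall N : nat, (0 < N)%N ->
      let r := N%:R `^ (- 2^-1) in
      let deltaPN :=
        CP * Num.max (modulus (deriv01 x) r)
                     (Num.max (modulus x r) (modulus u r)) in
      exists (cx : 'M[R]_(nx, N.+1)) (cu : 'M[R]_(nu, N.+1)),
        feasiblePN f e h deltaPN cx cu.
Proof.
have [ode bnd path] := feas_xu.
have C0x : C0_01 x.
  apply: coord_C0_01 => i; apply: derivable01_coord_continuous.
  by case: C1x.
have [Lf f_lip] := lipf; have [Lh h_lip] := liph.
pose K : R := 4 * (nx%:R + nu%:R).
have K0 : 0 <= K by rewrite mulr_ge0 // addr_ge0.
(* Lipschitz constants come with no sign, hence the absolute values below. *)
have Lf0 : 0 <= `|Lf| by [].
have Lh0 : 0 <= `|Lh| by [].
have nx0 : 0 <= nx%:R :> R by [].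
exists (1 + nx%:R * (4 + `|Lf| * K) + `|Lh| * K); split.
  by rewrite ltr_wpDr ?ltr_wpDr ?mulr_ge0 ?addr_ge0 ?mulr_ge0.
move=> N N0 /=; set r := _ `^ _; set m := Num.max _ _.
have N0' : 0 < N%:R :> R by rewrite ltr0n.
have r0 : 0 < r by rewrite powR_gt0.
have r2 : r ^+ 2 = N%:R^-1.
  rewrite -powR_mulrn ?(ltW r0) // -powRrM (_ : - 2^-1 * 2 = -1); last by field.
  by rewrite powR_inv1 // ltW.
have m_dx : modulus (deriv01 x) r <= m by rewrite le_max lexx.
have m_x : modulus x r <= m by rewrite !le_max lexx orbT.
have m_u : modulus u r <= m by rewrite !le_max lexx !orbT.
have m0 : 0 <= m.
  apply: le_trans m_x.
  rewrite (le_trans _ (le_modulus _ _ x r 0 0 C0x _ _ _)) //;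
    rewrite ?sqrtr_ge0 ?lexx ?ler01 // subrr normr0; exact: ltW.
exists (node_values N x), (node_values N u).
pose xN := bpoly (node_values N x); pose uN := bpoly (node_values N u).
have near_path t : 0 <= t <= 1 ->
    enorm (xN t - x t) + enorm (uN t - u t) <= K * m.
  move=> t01; have -> : K * m = nx%:R * (4 * m) + nu%:R * (4 * m).
    by rewrite /K; ring.
  apply: lerD.
    apply: enorm_le => [|i]; first by rewrite mulr_ge0.
    rewrite !mxE.
    rewrite (le_trans (bpoly_values_approx _ _ _ _ r _ i C0x N0 r0 r2 t01)) //.
    by rewrite ler_wpM2l.
  apply: enorm_le => [|i]; first by rewrite mulr_ge0.
  rewrite !mxE.
  rewrite (le_trans (bpoly_values_approx _ _ _ _ r _ i C0u N0 r0 r2 t01)) //.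
  by rewrite ler_wpM2l.
have lip_near n (k : 'cV[R]_nx -> 'cV[R]_nu -> 'cV[R]_n) L t i :
    (forall a b a' b', enorm (k a b - k a' b') <=
       L * (enorm (a - a') + enorm (b - b'))) -> 0 <= t <= 1 ->
    `|(k (xN t) (uN t) - k (x t) (u t)) i 0| <= `|L| * K * m.
  move=> k_lip t01; apply: le_trans (coord_le_enorm _ _ _ i) _.
  apply: le_trans (k_lip _ _ _ _) _.
  apply: (@le_trans _ _ (`|L| * (enorm (xN t - x t) + enorm (uN t - u t)))).
    by rewrite ler_wpM2r ?ler_norm // addr_ge0 // sqrtr_ge0.
  by rewrite -mulrA ler_wpM2l // near_path.
have node01 (j : 'I_N.+1) : 0 <= (j%:R / N%:R : R) <= 1.
  by rewrite divr_ge0 //= ler_pdivrMr // mul1r ler_nat -ltnS.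
split => [j||j i].
- have t01 := node01 j; set t := j%:R / _ in t01 *; have [_ ode_t] := ode t t01.
  apply: (@le_trans _ _ (nx%:R * ((4 + `|Lf| * K) * m))).
    apply: enorm_le => [|i]; first by rewrite mulr_ge0 // addr_ge0 // mulr_ge0.
    have dx := bpoly_values_deriv_approx _ _ _ _ r _ i C1x N0 r0 r2 t01.
    have fx := lip_near _ f Lf t i f_lip t01.
    rewrite ode_t in dx; move: dx fx; rewrite !mxE => dx fx.
    (* Insert [f (x t) (u t)], which is the derivative of [x] at [t]. *)
    rewrite -[X in `|X - _|](subrK (f (x t) (u t) i 0)) -addrA.
    rewrite mulrDl (le_trans (ler_normD _ _)) // lerD //.
      by rewrite (le_trans dx) // ler_wpM2l.
    by rewrite distrC.
  rewrite mulrA; apply: ler_wpM2r => //.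
  by have := mulr_ge0 Lh0 K0; lra.
- by rewrite /xN bpoly_values0 bpoly_values1.
- have t01 := node01 j; set t := j%:R / _ in t01 *.
  have := lip_near _ h Lh t i h_lip t01; rewrite !mxE ler_norml => /andP[_].
  have h_le0 := path t t01 i; move=> h_le.
  have rest_ge0 : 0 <= (1 + nx%:R * (4 + `|Lf| * K)) * m.
    by rewrite !(mulr_ge0, addr_ge0).
  rewrite -/xN -/uN mulrDl; lra.
Qed.
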